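(* The vector space $H^1_{\mathrm{Ad}\,\varrho_0}(\Gamma_{22},\mathfrak{isom}(\mathbb H^3))$ has dimension $12$.
   Context: $\mathbb R^{1,3}$ is $\mathbb R^4$ with the Minkowski form $-x_0^2+x_1^2+x_2^2+x_3^2$ and standard basis $e_0,\dots,e_3$; for a unit spacelike vector $v$, $r_v\in\mathrm O(1,3)$ is the reflection equal to $-1$ on $v$ and to the identity on $v^\perp$. $\mathfrak{isom}(\mathbb H^3)=\mathfrak{so}(1,3)$ is the Lie algebra of $\mathrm O(1,3)$, on which $\mathrm O(1,3)$ acts by the adjoint action $\mathrm{Ad}$. $\Gamma_{22}$ is the right-angled Coxeter group with $22$ generators $p_\varepsilon,m_\varepsilon$ ($\varepsilon=(\varepsilon_1,\varepsilon_2,\varepsilon_3)\in\{\pm1\}^3$), $\ell_{k,s}$ ($k\in\{1,2,3\}$, $s\in\{\pm1\}$), each of order two, with commutation relations: $p_\varepsilon$ and $m_\delta$ commute whenever $\varepsilon,\delta$ differ in at most one coordinate; $p_\varepsilon$ and $m_\varepsilon$ commute with $\ell_{k,s}$ whenever $\varepsilon_k=s$. $\varrho_0:\Gamma_{22}\to\mathrm O(1,3)$ is the representation with $\varrho_0(p_\varepsilon)=-\mathrm{id}$, $\varrho_0(m_\varepsilon)=r_{v_\varepsilon}$ where $v_\varepsilon=(\sqrt2,\varepsilon_1,\varepsilon_2,\varepsilon_3)$, and $\varrho_0(\ell_{k,s})=r_{v_{k,s}}$ where $v_{k,s}=e_0+s\sqrt2e_k$. $H^1_{\varrho}(\Gamma,V)=Z^1_\varrho(\Gamma,V)/B^1_\varrho(\Gamma,V)$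 is the usual first group cohomology: cocycles are maps $\tau:\Gamma\to V$ with $\tau(\gamma\eta)=\varrho(\gamma)\tau(\eta)+\tau(\gamma)$; coboundaries are maps $\gamma\mapsto\varrho(\gamma)v-v$ with $v\in V$. *)

(* Defs.v *)
From HB Require Import structures.
From mathcomp Require Import all_boot all_order all_algebra.
From mathcomp Require Import boolp functions reals.
From mathcomp Require Import ring.

Set Implicit Arguments.
Unset Strict Implicit.
Unset Printing Implicit Defensive.

Import Order.TTheory GRing.Theory Num.Theory.
Local Open Scope ring_scope.
Local Open Scope quotient_scope.

(* racg c is the right-angled Coxeter group with generators I and relations   *)
(* s * s = 1 for all s, and s * t = t * s whenever c s t. The generators are  *)
(* their own inverses, so it is the quotient of the free monoid seq I by the  *)
(* congruence generated by these relations; racg_lift is its universal        *)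
(* property.                                                                  *)
Section RACG.
Variables (I : choiceType) (c : rel I).

Inductive racg_cong : seq I -> seq I -> Prop :=
| racg_refl u : racg_cong u u
| racg_sym u v : racg_cong u v -> racg_cong v u
| racg_trans u v w : racg_cong u v -> racg_cong v w -> racg_cong u w
| racg_sqr u s v : racg_cong (u ++ [:: s; s] ++ v) (u ++ v)
| racg_comm u s t v : c s t ->
    racg_cong (u ++ [:: s; t] ++ v) (u ++ [:: t; s] ++ v).

Lemma racg_cat u u' v v' :
  racg_cong u u' -> racg_cong v v' -> racg_cong (u ++ v) (u' ++ v').
Proof.
move=> uu' vv'; apply: (@racg_trans _ (u' ++ v)).
  elim: uu' => {u u'} [u|u w _|u w x _ ? _|u s w|u s t w cst].
  - exact: racg_refl.
  - exact: racg_sym.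
  - exact: racg_trans.
  - by rewrite -!catA; exact: racg_sqr.
  - by rewrite -!catA; exact: racg_comm.
elim: vv' => {v v'} [v|v w _|v w x _ ? _|v s w|v s t w cst].
- exact: racg_refl.
- exact: racg_sym.
- exact: racg_trans.
- by rewrite !(catA u'); exact: racg_sqr.
- by rewrite !(catA u'); exact: racg_comm.
Qed.

Lemma racg_rev u v : racg_cong u v -> racg_cong (rev u) (rev v).
Proof.
elim=> {u v} [u|u v _|u v w _ ? _|u s v|u s t v cst].
- exact: racg_refl.
- exact: racg_sym.
- exact: racg_trans.
- by rewrite !rev_cat -catA; exact: racg_sqr.
- by rewrite !rev_cat -!catA; apply: racg_sym; exact: racg_comm.
Qed.

Lemma racg_revl u : racg_cong (rev u ++ u) [::].
Proof.
elim: u => [|s u IHu]; first exact: racg_refl.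
rewrite rev_cons -cats1 -catA.
by apply: racg_trans IHu; exact: racg_sqr.
Qed.

Definition racg_eqb : rel (seq I) := fun u v => `[< racg_cong u v >].

Lemma racg_eqb_equiv : equiv_class_of racg_eqb.
Proof.
split=> [u|u v|v u w]; first by apply/asboolP; exact: racg_refl.
- by apply/asboolP/asboolP; exact: racg_sym.
- by move=> /asboolP uv /asboolP vw; apply/asboolP; exact: racg_trans vw.
Qed.

Canonical racg_equiv := EquivRelPack racg_eqb_equiv.
Canonical racg_encModRel := defaultEncModRel racg_eqb.

Definition racg := {eq_quot racg_eqb}.
HB.instance Definition _ : EqQuotient _ racg_eqb racg := EqQuotient.on racg.
HB.instance Definition _ := Choice.on racg.

Lemma racgP u v : reflect (racg_cong u v) (u == v %[mod racg]).
Proof. by rewrite eqmodE; exact: asboolP. Qed.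

Lemma racg_repr u : racg_cong (repr (\pi_racg u)) u.
Proof. by apply/racgP; rewrite reprK. Qed.

Definition racg_one : racg := \pi_racg [::].
Definition racg_mul (x y : racg) : racg := \pi_racg (repr x ++ repr y).
Definition racg_inv (x : racg) : racg := \pi_racg (rev (repr x)).

Lemma racg_mulE u v : racg_mul (\pi_racg u) (\pi_racg v) = \pi_racg (u ++ v).
Proof. by apply/eqP/racgP/racg_cat; exact: racg_repr. Qed.

Lemma racg_invE u : racg_inv (\pi_racg u) = \pi_racg (rev u).
Proof. by apply/eqP/racgP/racg_rev/racg_repr. Qed.

Lemma racg_mulA : associative racg_mul.
Proof.
elim/quotW=> x; elim/quotW=> y; elim/quotW=> z.
by rewrite (racg_mulE y) (racg_mulE x y) !racg_mulE catA.
Qed.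

Lemma racg_mul1 : left_id racg_one racg_mul.
Proof. by elim/quotW=> u; rewrite racg_mulE. Qed.

Lemma racg_mulr1 : right_id racg_one racg_mul.
Proof. by elim/quotW=> u; rewrite racg_mulE cats0. Qed.

Lemma racg_mulV : left_inverse racg_one racg_inv racg_mul.
Proof.
elim/quotW=> u; rewrite racg_invE racg_mulE.
by apply/eqP/racgP/racg_revl.
Qed.

Lemma racg_mulrV : right_inverse racg_one racg_inv racg_mul.
Proof.
elim/quotW=> u; rewrite racg_invE racg_mulE -{1}[u]revK.
by apply/eqP/racgP/racg_revl.
Qed.

HB.instance Definition _ := isGroup.Build racg
  racg_mulA racg_mul1 racg_mulr1 racg_mulV racg_mulrV.

Definition racg_gen (s : I) : racg := \pi_racg [:: s].

Section Lift.
Variables (G : groupType) (f : I -> G).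
Hypothesis f2 : forall s, (f s * f s = 1)%g.
Hypothesis fC : forall s t, c s t -> (f s * f t = f t * f s)%g.

Definition racg_eval (u : seq I) : G := (\prod_(s <- u) f s)%g.

Lemma racg_eval_cong u v : racg_cong u v -> racg_eval u = racg_eval v.
Proof.
rewrite /racg_eval; elim=> {u v} // [u v w _ -> _ -> //|u s v|u s t v cst].
- by rewrite !big_cat !big_cons big_nil /= mulg1 f2 mul1g.
- by rewrite !big_cat !big_cons big_nil /= !mulg1 fC.
Qed.

Definition racg_lift_fun (x : racg) : G := racg_eval (repr x).

Lemma racg_lift_pi u : racg_lift_fun (\pi_racg u) = racg_eval u.
Proof. exact: racg_eval_cong (racg_repr u). Qed.

Lemma racg_lift_morph : {morph racg_lift_fun : x y / (x * y)%g}.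
Proof.
elim/quotW=> u; elim/quotW=> v; rewrite [(_ * _)%g]racg_mulE !racg_lift_pi.
by rewrite /racg_eval big_cat.
Qed.

HB.instance Definition _ :=
  isMultiplicative.Build racg G racg_lift_fun racg_lift_morph.

Definition racg_lift : {multiplicative racg -> G} := racg_lift_fun.

Lemma racg_liftE s : racg_lift (racg_gen s) = f s.
Proof. by rewrite /= racg_lift_pi /racg_eval big_seq1. Qed.

End Lift.
End RACG.

Record linrep (R : pzRingType) (G : groupType) (V : lmodType R) := LinRep {
  rep_fun :> G -> V -> V;
  rep_linear : forall g, linear (rep_fun g);
  rep1 : forall v, rep_fun 1%g v = v;
  repM : forall g h v, rep_fun (g * h)%g v = rep_fun g (rep_fun h v)
}.

Section RepComp.
Variables (R : pzRingType) (G H : groupType) (V : lmodType R).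
Variables (rho : linrep H V) (f : {multiplicative G -> H}).

Fact rep_comp1 v : rho (f 1%g) v = v.
Proof.
suff -> : f 1%g = 1%g by exact: rep1.
by apply: (mulgI (f 1%g)); rewrite -gmulfM !mulg1.
Qed.

Fact rep_compM g h v : rho (f (g * h)%g) v = rho (f g) (rho (f h) v).
Proof. by rewrite gmulfM repM. Qed.

Definition rep_comp : linrep G V :=
  LinRep (fun g => rep_linear rho (f g)) rep_comp1 rep_compM.

End RepComp.

Section Cohomology.
Variables (R : pzRingType) (G : groupType) (V : lmodType R) (rho : linrep G V).

Definition cocycle : {pred G -> V} := fun tau =>
  `[< forall g h : G, tau (g * h)%g = rho g (tau h) + tau g >].

Fact cocycle_submod : submod_closed cocycle.
Proof.
split=> [|a s t /asboolP sZ /asboolP tZ]; apply/asboolP => g h.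
  have zE x : (0 : G -> V) x = 0 by [].
  have := rep_linear rho g (-1) 0 0.
  by rewrite !zE addr0 !scaleN1r oppr0 addr0 addNr.
have sE x : (a *: s + t) x = a *: s x + t x by [].
by rewrite !sE sZ tZ rep_linear scalerDr addrACA.
Qed.

HB.instance Definition _ :=
  GRing.isSubmodClosed.Build R (G -> V) cocycle cocycle_submod.

Record Z1 := MkZ1 { Z1_fun :> G -> V; _ : Z1_fun \in cocycle }.

HB.instance Definition _ := [isSub for Z1_fun].
HB.instance Definition _ := [Choice of Z1 by <:].
HB.instance Definition _ := [SubChoice_isSubLmodule of Z1 by <:].

Definition coboundary : {pred Z1} := fun tau =>
  `[< exists v : V, forall g : G, tau g = rho g v - v >].

Fact coboundary_submod : submod_closed coboundary.
Proof.
have rho0 g : rho g 0 = 0.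
  by have := rep_linear rho g (-1) 0 0; rewrite !scaleN1r oppr0 addr0 addNr.
split=> [|a s t /asboolP[v sv] /asboolP[w tw]]; apply/asboolP.
  by exists 0 => g; rewrite rho0 subr0.
exists (a *: v + w) => g.
have -> : (a *: s + t) g = a *: s g + t g by [].
by rewrite sv tw rep_linear scalerBr opprD addrACA.
Qed.

HB.instance Definition _ :=
  GRing.isSubmodClosed.Build R Z1 coboundary coboundary_submod.

Definition H1 : Type := Quotient.quot coboundary.

HB.instance Definition _ := Quotient.on H1.
HB.instance Definition _ := GRing.Zmodule.on H1.

Definition H1_scale (a : R) (x : H1) : H1 := \pi_H1 (a *: repr x).

Lemma H1_scaleE a (t : Z1) : H1_scale a (\pi_H1 t) = \pi_H1 (a *: t).
Proof.
apply/eqP; rewrite -Quotient.idealrBE -scalerBr.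
by apply: rpredZ; rewrite Quotient.idealrBE reprK.
Qed.

Lemma H1_addE (s t : Z1) : \pi_H1 s + \pi_H1 t = \pi_H1 (s + t).
Proof. exact: esym (Quotient.pi_add _ _ _). Qed.

Lemma H1_scaleA a b x : H1_scale a (H1_scale b x) = H1_scale (a * b) x.
Proof. by elim/quotW: x => t; rewrite (H1_scaleE b) !H1_scaleE scalerA. Qed.

Lemma H1_scale1 : left_id 1 H1_scale.
Proof. by elim/quotW=> t; rewrite H1_scaleE scale1r. Qed.

Lemma H1_scaleDr : right_distributive H1_scale +%R.
Proof.
move=> a; elim/quotW=> s; elim/quotW=> t.
by rewrite H1_addE !H1_scaleE H1_addE scalerDr.
Qed.

Lemma H1_scaleDl x : {morph H1_scale^~ x : a b / a + b}.
Proof.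
by elim/quotW: x => t a b; rewrite !H1_scaleE H1_addE scalerDl.
Qed.

HB.instance Definition _ := GRing.Zmodule_isLmodule.Build R H1
  H1_scaleA H1_scale1 H1_scaleDr H1_scaleDl.

End Cohomology.

Section Minkowski.
Variable R : realType.

Definition mink_mx : 'M[R]_4 :=
  diag_mx (\row_i (if i == ord0 then -1 else 1)).
Local Notation J := mink_mx.

Definition mink (x y : 'cV[R]_4) : R := (x^T *m J *m y) 0 0.

Lemma minkE x y :
  mink x y = - (x ord0 0 * y ord0 0)
             + \sum_(k < 3) x (lift ord0 k) 0 * y (lift ord0 k) 0.
Proof.
rewrite /mink mxE big_ord_recl; congr (_ + _).
  by rewrite mul_mx_diag !mxE /= mulrN1 mulNr.
by apply: eq_bigr => k _; rewrite mul_mx_diag !mxE /= mulr1.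
Qed.

Lemma minkC x y : mink x y = mink y x.
Proof.
by rewrite !minkE mulrC; congr (_ + _); apply: eq_bigr => k _; rewrite mulrC.
Qed.

Lemma mink_mxK : J *m J = 1%:M.
Proof.
rewrite mulmx_diag -diag_const_mx; congr diag_mx.
by apply/rowP => i; rewrite !mxE; case: ifP; rewrite ?mulrNN mulr1.
Qed.

Lemma tr_mink_mx : J^T = J.
Proof. exact: tr_diag_mx. Qed.

Definition is_O13 (A : 'M[R]_4) : bool := A^T *m J *m A == J.

Record O13 := MkO13 { O13_mx :> 'M[R]_4; O13P : is_O13 O13_mx }.

HB.instance Definition _ := [isSub for O13_mx].
HB.instance Definition _ := [Choice of O13 by <:].

Lemma O13E (A : O13) : A^T *m J *m A = J.
Proof. exact/eqP/O13P. Qed.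

Fact O13_one_subproof : is_O13 1%:M.
Proof. by rewrite /is_O13 trmx1 mul1mx mulmx1. Qed.

Fact O13_mul_subproof (A B : O13) : is_O13 (A *m B).
Proof.
by rewrite /is_O13 trmx_mul -!mulmxA (mulmxA J) (mulmxA A^T) (mulmxA A^T) O13E
   mulmxA O13E.
Qed.

Lemma O13_mulVmx (A : O13) : (J *m A^T *m J) *m A = 1%:M.
Proof. by rewrite -!mulmxA (mulmxA A^T) O13E mink_mxK. Qed.

Lemma O13_mulmxV (A : O13) : A *m (J *m A^T *m J) = 1%:M.
Proof. exact: mulmx1C (O13_mulVmx A). Qed.

Fact O13_inv_subproof (A : O13) : is_O13 (J *m A^T *m J).
Proof.
rewrite /is_O13 !trmx_mul trmxK tr_mink_mx.
rewrite -!mulmxA [J *m (J *m _)]mulmxA mink_mxK mul1mx.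
have := O13_mulmxV A; rewrite -!mulmxA => ->.
by rewrite mulmx1.
Qed.

Definition O13_one := MkO13 O13_one_subproof.
Definition O13_mul A B := MkO13 (O13_mul_subproof A B).
Definition O13_inv A := MkO13 (O13_inv_subproof A).

Fact O13_mulA : associative O13_mul.
Proof. by move=> A B C; apply/val_inj; rewrite /= mulmxA. Qed.
Fact O13_mul1 : left_id O13_one O13_mul.
Proof. by move=> A; apply/val_inj; rewrite /= mul1mx. Qed.
Fact O13_mulr1 : right_id O13_one O13_mul.
Proof. by move=> A; apply/val_inj; rewrite /= mulmx1. Qed.
Fact O13_mulV : left_inverse O13_one O13_inv O13_mul.
Proof. by move=> A; apply/val_inj/O13_mulVmx. Qed.
Fact O13_mulrV : right_inverse O13_one O13_inv O13_mul.
Proof. by move=> A; apply/val_inj/O13_mulmxV. Qed.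

HB.instance Definition _ := isGroup.Build O13
  O13_mulA O13_mul1 O13_mulr1 O13_mulV O13_mulrV.

Fact O13_opp_subproof : is_O13 (- 1%:M).
Proof.
rewrite /is_O13 [(- _)^T](linearN trmx) /= trmx1 mulNmx mul1mx mulmxN mulmx1.
by rewrite opprK.
Qed.

Definition O13_opp : O13 := MkO13 O13_opp_subproof.

(* For mink v v = 1 this is the reflection r_v, acting on column vectors; see *)
(* refl_mx_self and refl_mx_orth.                                             *)
Definition refl_mx (v : 'cV[R]_4) : 'M[R]_4 := 1%:M - 2 *: (v *m v^T *m J).

Lemma refl_mxE v x : refl_mx v *m x = x - (2 * mink v x) *: v.
Proof.
rewrite mulmxBl mul1mx -scalemxAl -!mulmxA -scalerA; congr (_ - 2 *: _).
by rewrite [v^T *m _]mx11_scalar mul_mx_scalar /mink mulmxA.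
Qed.

Lemma refl_mx_self v : mink v v = 1 -> refl_mx v *m v = - v.
Proof.
move=> v1; rewrite refl_mxE v1 mulr1 scaler_nat mulr2n opprD addrA subrr.
by rewrite add0r.
Qed.

Lemma refl_mx_orth v x : mink v x = 0 -> refl_mx v *m x = x.
Proof. by move=> vx; rewrite refl_mxE vx mulr0 scale0r subr0. Qed.

Lemma mink_mid v w : v *m v^T *m J *m (w *m w^T) = mink v w *: (v *m w^T).
Proof.
rewrite -!mulmxA (mulmxA v^T) (mulmxA (v^T *m J)).
by rewrite [v^T *m J *m w]mx11_scalar mul_scalar_mx -scalemxAr.
Qed.

Fact refl_subproof v : mink v v = 1 -> is_O13 (refl_mx v).
Proof.
move=> v1; have := mink_mid v v; rewrite v1 scale1r => PJP.
apply/eqP; rewrite /refl_mx [(_ - _)^T](linearB trmx) /= linearZ /= !trmx_mul.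
rewrite trmxK trmx1 tr_mink_mx; set P := v *m v^T in PJP *.
rewrite mulmxBl mul1mx -scalemxAl mulmxBr mulmx1 mulmxBl -!scalemxAr -scalemxAl.
have -> : J *m P *m J *m (P *m J) = J *m P *m J.
  by rewrite mulmxA -(mulmxA J P) -(mulmxA J _ P) PJP mulmxA.
rewrite /P !mulmxA.
by apply/matrixP => i j; rewrite !mxE; ring.
Qed.

Lemma refl_mx_comm v w : mink v w = 0 ->
  refl_mx v *m refl_mx w = refl_mx w *m refl_mx v.
Proof.
move=> vw; have wv : mink w v = 0 by rewrite minkC.
have Q0 x y : mink x y = 0 -> x *m x^T *m J *m (y *m y^T *m J) = 0.
  by move=> xy; rewrite mulmxA mink_mid xy scale0r mul0mx.
rewrite /refl_mx !(mulmxBl, mulmxBr) !mul1mx !mulmx1 -!scalemxAl -!scalemxAr.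
by rewrite !Q0 // !scaler0 !subr0 addrAC.
Qed.

Lemma refl_mxK v : mink v v = 1 -> refl_mx v *m refl_mx v = 1%:M.
Proof.
move=> v1; have := mink_mid v v; rewrite v1 scale1r => PJP.
rewrite /refl_mx !(mulmxBl, mulmxBr) !mul1mx !mulmx1 -!scalemxAl -!scalemxAr.
rewrite (mulmxA (_ *m J)) PJP; move: (_ *m J) (1%:M) => Q K.
by apply/matrixP => i j; rewrite !mxE; ring.
Qed.

Definition refl v (v1 : mink v v = 1) : O13 := MkO13 (refl_subproof v1).

(* X^T J + J X = 0 is the linearization at the identity of the equation       *)
(* A^T J A = J defining O(1,3).                                               *)
Definition so13_pred : {pred 'M[R]_4} := fun X => X^T *m J + J *m X == 0.

Fact so13_submod : submod_closed so13_pred.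
Proof.
split=> [|a X Y /eqP X0 /eqP Y0]; apply/eqP.
  by rewrite trmx0 mul0mx mulmx0 addr0.
rewrite linearP /= mulmxDl mulmxDr -scalemxAl -scalemxAr addrACA -scalerDr.
by rewrite X0 Y0 scaler0 addr0.
Qed.

HB.instance Definition _ :=
  GRing.isSubmodClosed.Build R 'M[R]_4 so13_pred so13_submod.

Record so13 := MkSo13 { so13_mx :> 'M[R]_4; so13P : so13_mx \in so13_pred }.

HB.instance Definition _ := [isSub for so13_mx].
HB.instance Definition _ := [Choice of so13 by <:].
HB.instance Definition _ := [SubChoice_isSubLmodule of so13 by <:].

Fact Ad_subproof (A : O13) (X : so13) :
  A *m X *m (A^-1)%g \in so13_pred.
Proof.
have /eqP X0 := so13P X; set B : 'M_4 := (A^-1)%g.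
have JB : A^T *m J = J *m B by rewrite /B /= !mulmxA mink_mxK mul1mx.
have BJ : J *m A = B^T *m J.
  by rewrite /B /= !trmx_mul trmxK tr_mink_mx -!mulmxA mink_mxK mulmx1.
move: B JB BJ => B JB BJ; apply/eqP.
rewrite !trmx_mul -!mulmxA JB !mulmxA BJ.
by rewrite -mulmxDl -(mulmxA B^T J) -(mulmxA B^T) -mulmxDr X0 mulmx0 mul0mx.
Qed.

Definition Ad_fun (A : O13) (X : so13) : so13 := MkSo13 (Ad_subproof A X).

Fact Ad_linear A : linear (Ad_fun A).
Proof.
by move=> a X Y; apply/val_inj; rewrite /= mulmxDr mulmxDl -scalemxAr -scalemxAl.
Qed.

Fact Ad1 X : Ad_fun 1%g X = X.
Proof.
apply/val_inj; change (O13_mx 1%g *m X *m O13_mx (1^-1)%g = X).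
by rewrite invg1 mul1mx mulmx1.
Qed.

Fact AdM A B X : Ad_fun (A * B)%g X = Ad_fun A (Ad_fun B X).
Proof.
apply/val_inj.
change (O13_mx (A * B)%g *m X *m O13_mx ((A * B)^-1)%g =
        A *m (B *m X *m O13_mx (B^-1)%g) *m O13_mx (A^-1)%g).
rewrite invgM; change (A *m B *m X *m (O13_mx (B^-1)%g *m O13_mx (A^-1)%g) =
        A *m (B *m X *m O13_mx (B^-1)%g) *m O13_mx (A^-1)%g).
by rewrite !mulmxA.
Qed.

Definition Ad : linrep O13 so13 := LinRep Ad_linear Ad1 AdM.

End Minkowski.

(* A sign in {1, -1} is encoded by the boolean b such that it equals          *)
(* (-1) ^+ b, and k in {1, 2, 3} by its predecessor in 'I_3, so that e_k is   *)
(* the basis vector of index lift ord0 k in 'I_4.                             *)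
Inductive gen22 : Type :=
| Pgen of {ffun 'I_3 -> bool}
| Mgen of {ffun 'I_3 -> bool}
| Lgen of 'I_3 & bool.

Definition gen22_code (s : gen22) :
    {ffun 'I_3 -> bool} + {ffun 'I_3 -> bool} + 'I_3 * bool :=
  match s with
  | Pgen e => inl (inl e) | Mgen e => inl (inr e) | Lgen k b => inr (k, b)
  end.

Definition gen22_decode
    (x : {ffun 'I_3 -> bool} + {ffun 'I_3 -> bool} + 'I_3 * bool) : gen22 :=
  match x with
  | inl (inl e) => Pgen e | inl (inr e) => Mgen e | inr (k, b) => Lgen k b
  end.

Lemma gen22_codeK : cancel gen22_code gen22_decode.
Proof. by case. Qed.

HB.instance Definition _ := Finite.copy gen22 (can_type gen22_codeK).

Lemma card_gen22 : #|{: gen22}| = 22%N.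
Proof.
have gK : cancel gen22_decode gen22_code by case=> [[]|[]].
rewrite (bij_eq_card (Bijective gen22_codeK gK)).
by rewrite !card_sum card_prod !card_ffun !card_ord card_bool.
Qed.

Definition comm22 (s t : gen22) : bool :=
  match s, t with
  | Pgen e, Mgen d => #|[set k | e k != d k]| <= 1
  | Pgen e, Lgen k b | Mgen e, Lgen k b => e k == b
  | _, _ => false
  end%N.

Definition Gamma22 := racg comm22.
HB.instance Definition _ := Group.on Gamma22.

Section Rho0.
Variable R : realType.

Definition ebasis (i : 'I_4) : 'cV[R]_4 := delta_mx i 0.

Definition mvec (e : {ffun 'I_3 -> bool}) : 'cV[R]_4 :=
  Num.sqrt 2 *: ebasis ord0 + \sum_(k < 3) (-1) ^+ e k *: ebasis (lift ord0 k).

Definition lvec (k : 'I_3) (b : bool) : 'cV[R]_4 :=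
  ebasis ord0 + ((-1) ^+ b * Num.sqrt 2) *: ebasis (lift ord0 k).

Lemma mvec0 e : mvec e ord0 0 = Num.sqrt 2.
Proof.
rewrite mxE summxE big1 ?addr0 => [|k _]; rewrite !mxE ?mulr1 //=.
by rewrite mulr0.
Qed.

Lemma mvecS e k : mvec e (lift ord0 k) 0 = (-1) ^+ e k.
Proof.
rewrite mxE summxE (bigD1 k) //= big1 => [|i ik]; rewrite !mxE !eqxx /=.
  by rewrite mulr0 add0r addr0 mulr1.
by rewrite (inj_eq lift_inj) eq_sym (negPf ik) mulr0.
Qed.

Lemma lvec0 k b : lvec k b ord0 0 = 1.
Proof. by rewrite !mxE /= mulr0 addr0. Qed.

Lemma lvecS k b i :
  lvec k b (lift ord0 i) 0 = (-1) ^+ b * Num.sqrt 2 * (i == k)%:R.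
Proof. by rewrite !mxE /= (inj_eq lift_inj) andbT add0r. Qed.

Lemma sqrt2M : Num.sqrt 2 * Num.sqrt 2 = 2 :> R.
Proof. by rewrite -expr2 sqr_sqrtr ?ler0n. Qed.

Lemma mvec_unit e : mink (mvec e) (mvec e) = 1.
Proof.
rewrite minkE mvec0 sqrt2M (eq_bigr (fun=> 1)) => [|k _].
  by rewrite sumr_const card_ord; ring.
by rewrite mvecS -expr2 sqrr_sign.
Qed.

Lemma lvec_unit k b : mink (lvec k b) (lvec k b) = 1.
Proof.
rewrite minkE lvec0 (bigD1 k) //= big1 => [|i ik].
  by rewrite lvecS eqxx !mulr1 mulrACA -expr2 sqrr_sign sqrt2M; ring.
by rewrite lvecS (negPf ik) !mulr0.
Qed.

Lemma mvec_lvec (e : {ffun 'I_3 -> bool}) k b :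
  e k = b -> mink (mvec e) (lvec k b) = 0.
Proof.
move=> ekb; rewrite minkE mvec0 lvec0 (bigD1 k) //= big1 => [|i ik].
  by rewrite mvecS lvecS ekb eqxx !mulr1 mulrA -expr2 sqrr_sign; ring.
by rewrite lvecS (negPf ik) !mulr0.
Qed.

Definition rho0_gen (s : gen22) : O13 R :=
  match s with
  | Pgen _ => O13_opp R
  | Mgen e => refl (mvec_unit e)
  | Lgen k b => refl (lvec_unit k b)
  end.

Lemma rho0_gen2 s : (rho0_gen s * rho0_gen s = 1)%g.
Proof.
case: s => [e|e|k b]; apply/val_inj => /=.
- by rewrite mulNmx mul1mx opprK.
- exact/refl_mxK/mvec_unit.
- exact/refl_mxK/lvec_unit.
Qed.

Lemma rho0_genC s t : comm22 s t ->
  (rho0_gen s * rho0_gen t = rho0_gen t * rho0_gen s)%g.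
Proof.
have oppC (A : O13 R) : (O13_opp R * A = A * O13_opp R)%g.
  by apply/val_inj; rewrite /= mulNmx mulmxN mul1mx mulmx1.
case: s t => [e|e|k b] [d|d|i a] //= st.
by apply/val_inj/refl_mx_comm/mvec_lvec/eqP.
Qed.

Definition rho0 : {multiplicative Gamma22 -> O13 R} :=
  racg_lift rho0_gen2 rho0_genC.

Lemma rho0E s : rho0 (racg_gen comm22 s) = rho0_gen s.
Proof. exact: racg_liftE. Qed.

End Rho0.

(* Main.v *)
(* A cocycle is determined by its values on the generators. It vanishes on    *)
(* p_e, since Ad(-id) = id, and its value on the reflection in a unit vector  *)
(* v is v /\ w for some w in the orthogonal of v. The relations with the p_e  *)
(* impose nothing, while the commutation of m_e with l_{k,s} becomes          *)
(* <m_e, w_l> + <l_{k,s}, w_m> = 0. The three l_{k,s} orthogonal to m_e form  *)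
(* a basis of the orthogonal of m_e, so the six vectors w_l can be prescribed *)
(* arbitrarily (6 * 3 = 18 parameters) and determine the w_m. Coboundaries    *)
(* are the families w_l = X l with X in so(1,3), which leaves 18 - 6 = 12     *)
(* explicit invariants of the family (w_l).                                   *)
From HB Require Import structures.
Require Import Defs.
From mathcomp Require Import all_boot all_order all_algebra.
From mathcomp Require Import boolp functions reals.
From mathcomp Require Import ring lra.

Set Implicit Arguments.
Unset Strict Implicit.
Unset Printing Implicit Defensive.

Import Order.TTheory GRing.Theory Num.Theory.
Local Open Scope ring_scope.
Local Open Scope quotient_scope.

(** A surjective linear map from cocycles to row vectors of length 12 whose kernel is the space of
    coboundaries computes the dimension ([H1_vector_axiom]); here it is [h1_map]. On a Coxeter group
    a cocycle amounts to values on the generators satisfying one linear equation per relation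
    ([racg_cocycle_extend]). At a reflection r_v, the relation of order two makes the value
    [wedge v w] with w orthogonal to v, an infinitesimal motion of the unit normal v
    ([Ad_refl_anti]); commutation of two reflections with orthogonal normals becomes the derivative
    of that orthogonality ([Ad_refl_comm]).

    For each e, the vector [mvec e] and the three [lvec k (e k)] form a basis, so the motion of
    [mvec e] is the unique solution of a linear system given by the motions of the [lvec]
    ([mvec_frame_inj], [mvec_frame_surj]). Cocycles thus correspond to arbitrary families W with
    [W k b] orthogonal to [lvec k b] ([ldef_inj], [ldef_surj]), and coboundaries to the families X l
    with X in so(1,3). The 12 linear forms of [h1_coord] vanish exactly on the latter
    ([h1_coord_so13], [h1_coord_inj]) and are independent ([h1_coord_surj]). *)

Section Cocycles.
Variables (R : pzRingType) (G : groupType) (V : lmodType R) (rho : linrep G V).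

(** * Cocycles, coboundaries and the dimension of their quotient *)

Lemma linrep0 g : rho g 0 = 0.
Proof.
by have := rep_linear rho g (-1) 0 0; rewrite !scaleN1r oppr0 addr0 addNr.
Qed.

Lemma linrepD g : {morph rho g : v w / v + w}.
Proof. by move=> v w; have := rep_linear rho g 1 v w; rewrite !scale1r. Qed.

Lemma linrepB g : {morph rho g : v w / v - w}.
Proof.
move=> v w; have := rep_linear rho g (-1) w v.
by rewrite !scaleN1r ![- _ + _]addrC.
Qed.

Lemma cocycleM (t : Z1 rho) g h : t (g * h)%g = rho g (t h) + t g.
Proof. by case: t => t /= /asboolP. Qed.

Lemma cocycle1 (t : Z1 rho) : t 1%g = 0.
Proof.
by apply: (addrI (t 1%g)); rewrite -[X in X + _ = _](rep1 rho) -cocycleM mulg1 addr0.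
Qed.

Lemma cocycle_invol (t : Z1 rho) g : (g * g = 1)%g -> rho g (t g) = - t g.
Proof. by move=> gg; apply/eqP; rewrite -addr_eq0 -cocycleM gg cocycle1. Qed.

Fact coboundary_of_subproof v : (fun g => rho g v - v) \in cocycle rho.
Proof. by apply/asboolP => g h; rewrite repM linrepB addrA subrK. Qed.

Definition coboundary_of v : Z1 rho := MkZ1 (coboundary_of_subproof v).

Lemma coboundaryP (t : Z1 rho) :
  reflect (exists v, t = coboundary_of v) (t \in @coboundary R G V rho).
Proof.
apply: (iffP (asboolP _)) => -[v tv]; exists v; last by rewrite tv.
by apply/val_inj/funext.
Qed.

End Cocycles.

Lemma H1_vector_axiom (R : nzRingType) (G : groupType) (V : lmodType R)
    (rho : linrep G V) n (f : {linear Z1 rho -> 'rV[R]_n}) :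
    (forall t, f t = 0 <-> t \in @coboundary R G V rho) ->
    (forall x, exists t, f t = x) ->
  inhabited (Vector.axiom n (H1 rho)).
Proof.
move=> f0 /choice[g gK].
(* As f kills coboundaries, its value does not depend on the representative of a class. *)
have fpi t : f (repr (\pi_(H1 rho) t)) = f t.
  apply/eqP; rewrite -subr_eq0 -raddfB; apply/eqP/f0.
  by rewrite Quotient.idealrBE reprK.
constructor; exists (f \o repr).
  move=> a; elim/quotW=> s; elim/quotW=> t /=.
  have -> : a *: \pi_(H1 rho) s + \pi_(H1 rho) t = \pi_(H1 rho) (a *: s + t).
    by rewrite -H1_addE; congr (_ + _); exact: H1_scaleE.
  by rewrite !fpi linearP.
exists (\pi_(H1 rho) \o g) => [|x] /=; last by rewrite fpi.
elim/quotW=> t /=; rewrite fpi; apply/eqP; rewrite -Quotient.idealrBE.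
by apply/f0; rewrite raddfB; apply/eqP; rewrite subr_eq0; apply/eqP/gK.
Qed.

(** * Cocycles on a right-angled Coxeter group *)

Section RACGCocycles.
Variables (R : pzRingType) (I : choiceType) (c : rel I) (V : lmodType R).
Variable rho : linrep (racg c) V.

Lemma racg_pi_cons s u :
  \pi_(racg c) (s :: u) = (racg_gen c s * \pi_(racg c) u)%g.
Proof. by rewrite [RHS]racg_mulE. Qed.

Lemma racg_gen2 s : (racg_gen c s * racg_gen c s = 1)%g.
Proof.
by rewrite [LHS]racg_mulE; apply/eqP/racgP; exact: (racg_sqr c [::] s [::]).
Qed.

Lemma racg_genC s t : c s t ->
  (racg_gen c s * racg_gen c t = racg_gen c t * racg_gen c s)%g.
Proof.
move=> cst; rewrite [LHS]racg_mulE [RHS]racg_mulE.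
by apply/eqP/racgP; exact: (racg_comm [::] [::] cst).
Qed.

Lemma racg_cocycle_eq (t t' : Z1 rho) :
  (forall s, t (racg_gen c s) = t' (racg_gen c s)) -> t = t'.
Proof.
move=> tt'; apply/val_inj/funext => x; change (t x = t' x).
elim/quotW: x; elim=> [|s u IHu]; first by rewrite (cocycle1 t) (cocycle1 t').
by rewrite racg_pi_cons !cocycleM IHu tt'.
Qed.

(** A cocycle is the translation part of an affine action with linear part [rho]. The hypotheses say
    that the affine maps y |-> rho(s) y + t(s) satisfy the Coxeter relations; the cocycle is then
    the orbit map of 0. *)
Lemma racg_cocycle_extend (t : I -> V) :
    (forall s, rho (racg_gen c s) (t s) = - t s) ->
    (forall s s', c s s' -> rho (racg_gen c s) (t s') + t s =
                            rho (racg_gen c s') (t s) + t s') ->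
  exists tau : Z1 rho, forall s, tau (racg_gen c s) = t s.
Proof.
move=> t2 tC.
(* The composite along the word u of the affine maps of its letters, applied to x. *)
pose ext u x := foldr (fun s y => rho (racg_gen c s) y + t s) x u.
have extD u x y : ext u (x + y) = rho (\pi_(racg c) u) x + ext u y.
  elim: u => [|s u IHu] /=; first by rewrite (rep1 rho).
  by rewrite IHu racg_pi_cons repM linrepD addrA.
have ext_cong u v : racg_cong c u v -> forall x, ext u x = ext v x.
  elim=> {u v} // [u v w _ uv _ vw x|u s v x|u s s' v css' x].
  - by rewrite uv.
  - rewrite /ext !foldr_cat /=; congr foldr.
    by rewrite linrepD -repM racg_gen2 rep1 t2 subrK.
  rewrite /ext !foldr_cat /=; congr foldr.
  by rewrite !linrepD -!repM racg_genC // -!addrA tC.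
pose tau (x : racg c) := ext (repr x) 0.
have tauE u : tau (\pi_(racg c) u) = ext u 0 by exact/ext_cong/racg_repr.
have tauZ : tau \in cocycle rho.
  apply/asboolP; elim/quotW=> u; elim/quotW=> v.
  rewrite [(_ * _)%g]racg_mulE !tauE {1}/ext foldr_cat -/(ext v 0).
  by rewrite -/(ext u _) -[ext v 0]addr0 extD addr0.
exists (MkZ1 tauZ) => s; change (tau (\pi_(racg c) [:: s]) = t s).
by rewrite tauE /= linrep0 add0r.
Qed.

End RACGCocycles.

(** * Bivectors in so(1,3) and the adjoint action of reflections *)

Section Minkowski.
Variable R : realType.
Implicit Types (x y v w : 'cV[R]_4) (X Y : so13 R) (A : O13 R).
Local Notation J := (mink_mx R).

Lemma minkDl x y w : mink (x + y) w = mink x w + mink y w.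
Proof. by rewrite /mink linearD /= !mulmxDl mxE. Qed.

Lemma minkZl a x w : mink (a *: x) w = a * mink x w.
Proof. by rewrite /mink linearZ /= -!scalemxAl mxE. Qed.

Lemma minkDr x y w : mink w (x + y) = mink w x + mink w y.
Proof. by rewrite minkC minkDl !(minkC w). Qed.

Lemma minkZr a x w : mink w (a *: x) = a * mink w x.
Proof. by rewrite minkC minkZl (minkC w). Qed.

Lemma minkNl x w : mink (- x) w = - mink x w.
Proof. by rewrite -scaleN1r minkZl mulN1r. Qed.

Lemma minkNr x w : mink w (- x) = - mink w x.
Proof. by rewrite minkC minkNl (minkC w). Qed.

Lemma so13_mulmxD X Y x : (X + Y) *m x = X *m x + Y *m x.
Proof. exact: mulmxDl. Qed.

Lemma mink_mulmx v w x : v *m w^T *m J *m x = mink w x *: v.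
Proof. by rewrite -!mulmxA (mulmxA w^T) [_ *m x]mx11_scalar mul_mx_scalar. Qed.

Lemma mink_skew X x y : mink (X *m x) y = - mink x (X *m y).
Proof.
have /eqP/(canRL (addrK _)) := so13P X; rewrite sub0r => XJ.
by rewrite /mink trmx_mul -!mulmxA (mulmxA X^T) XJ mulNmx mulmxN mxE !mulmxA.
Qed.

Lemma mink_skew_self X x : mink x (X *m x) = 0.
Proof.
have := mink_skew X x x; rewrite minkC => /eqP.
by rewrite -addr_eq0 -mulr2n mulrn_eq0 /= => /eqP.
Qed.

Lemma mink_O13 A x y : mink (A *m x) (A *m y) = mink x y.
Proof. by rewrite /mink trmx_mul -!mulmxA (mulmxA A^T) (mulmxA _ A) O13E !mulmxA. Qed.

Fact wedge_subproof v w : (w *m v^T - v *m w^T) *m J \in @so13_pred R.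
Proof.
apply/eqP; rewrite trmx_mul tr_mink_mx linearB /= !trmx_mul !trmxK.
by rewrite mulmxA -mulmxDl -mulmxDr addrA subrK subrr mulmx0 mul0mx.
Qed.

Definition wedge v w : so13 R := MkSo13 (wedge_subproof v w).

Lemma wedgeE v w x : wedge v w *m x = mink v x *: w - mink w x *: v.
Proof. by rewrite /= !mulmxBl !mink_mulmx. Qed.


Lemma AdE A X x : Ad R A X *m (A *m x) = A *m (X *m x).
Proof.
have AV : O13_mx (A^-1)%g *m A = 1%:M := O13_mulVmx A.
change (A *m X *m O13_mx (A^-1)%g *m (A *m x) = A *m (X *m x)).
by rewrite mulmxA -(mulmxA (A *m X)) AV mulmx1 mulmxA.
Qed.

(** Testing on the vectors A x suits [AdE], which evaluates [Ad A X] exactly there. *)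
Lemma so13_eq A X Y : (forall x, X *m (A *m x) = Y *m (A *m x)) -> X = Y.
Proof.
move=> XY; have XA : X *m A = Y *m A.
  apply/matrixP => i j; have := XY (delta_mx j 0).
  by rewrite !mulmxA -!colE => /colP/(_ i); rewrite !mxE.
apply/val_inj; rewrite /= -[LHS]mulmx1 -[RHS]mulmx1 -(O13_mulmxV A).
by rewrite !(mulmxA _ A) XA.
Qed.

Lemma Ad_opp X : Ad R (O13_opp R) X = X.
Proof.
by apply: (@so13_eq (O13_opp R)) => x; rewrite AdE /= !mulNmx !mul1mx mulmxN.
Qed.

Lemma Ad_wedge A v w : Ad R A (wedge v w) = wedge (A *m v) (A *m w).
Proof.
apply: (@so13_eq A) => x.
by rewrite AdE !wedgeE !mink_O13 mulmxBr -!scalemxAr.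
Qed.

Lemma wedgeNl v w : wedge (- v) w = - wedge v w.
Proof.
apply/val_inj; rewrite /= (linearN trmx) /= mulmxN (mulNmx v) opprK.
by rewrite -[RHS]mulNmx opprB addrC.
Qed.

Lemma wedge0r v : wedge v 0 = 0.
Proof. by apply/val_inj; rewrite /= trmx0 mulmx0 mul0mx subr0 mul0mx. Qed.

Lemma wedge_unit v w : mink v v = 1 -> mink v w = 0 -> wedge v w *m v = w.
Proof. by move=> v1 vw; rewrite wedgeE minkC v1 minkC minkC vw scale1r scale0r subr0. Qed.

Lemma Ad_refl_wedge v (v1 : mink v v = 1) w : mink v w = 0 ->
  Ad R (refl v1) (wedge v w) = - wedge v w.
Proof. by move=> vw; rewrite Ad_wedge refl_mx_self // refl_mx_orth // wedgeNl. Qed.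

(** Anti-invariance gives X x = <v, x> X v + <v, X x> v, and skewness turns <v, X x> into - <X v,
    x>. *)
Lemma Ad_refl_anti v (v1 : mink v v = 1) X :
  Ad R (refl v1) X = - X -> X = wedge v (X *m v).
Proof.
move=> rX; apply: (@so13_eq 1%g) => x; rewrite mul1mx wedgeE mink_skew.
have := AdE (refl v1) X x; rewrite rX /= mulNmx !refl_mxE mulmxBr -scalemxAr.
move: (X *m x) (X *m v) => p q E.
rewrite scaleNr opprK; apply/colP => i; move/colP/(_ i): E; rewrite !mxE; lra.
Qed.

(** Since r_v y = y - 2 <v, y> v and r_v w = w, the reflection r_v changes w /\ y only by a multiple
    of v /\ w, and symmetrically for r_w. The equation compares two multiples of this one
    bivector. *)
Lemma Ad_refl_comm v w (v1 : mink v v = 1) (w1 : mink w w = 1) x y :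
    mink v w = 0 -> mink v x = 0 -> mink w y = 0 ->
  Ad R (refl v1) (wedge w y) + wedge v x = Ad R (refl w1) (wedge v x) + wedge w y
  <-> mink v y + mink w x = 0.
Proof.
move=> vw vx wy; have wv : mink w v = 0 by rewrite minkC.
rewrite !Ad_wedge /= (refl_mx_orth vw) (refl_mx_orth wv) !refl_mxE.
(* Applying both sides to w and pairing with v reads off the coefficient of v /\ w. *)
split=> [/(congr1 (fun X => mink v (so13_mx X *m w))) | /(canRL (addrK _)) E].
  rewrite !so13_mulmxD !wedgeE.
  rewrite !(minkDl, minkDr, minkNl, minkNr, minkZl, minkZr).
  rewrite vw v1 w1 vx (minkC x w) (minkC y w) wy; lra.
apply: (@so13_eq 1%g) => z; rewrite mul1mx !so13_mulmxD !wedgeE.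
rewrite !(minkDl, minkNl, minkZl) E; apply/colP => i; rewrite !mxE; ring.
Qed.

End Minkowski.

(** * The frames formed by [mvec e] and its three orthogonal [lvec] *)

Section Deformations.
Variable R : realType.
Implicit Types (w : 'cV[R]_4) (e : {ffun 'I_3 -> bool}) (k : 'I_3) (b : bool).
Implicit Types (W : 'I_3 -> bool -> 'cV[R]_4).
Local Notation rho := (rep_comp (Ad R) (rho0 R)).
Local Notation s2 := (Num.sqrt 2 : R).
Local Notation gen := (racg_gen comm22).
Implicit Types (t : Z1 rho) (X : so13 R).

Lemma sqrt2_neq0 : s2 != 0.
Proof. by rewrite sqrtr_eq0 -ltNge ltr0n. Qed.

Definition tscol (a : R) (f : 'I_3 -> R) : 'cV[R]_4 :=
  \col_i (if unlift ord0 i is Some k then f k else a).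

Lemma tscol0 a f : tscol a f ord0 0 = a.
Proof. by rewrite mxE unlift_none. Qed.

Lemma tscolS a f k : tscol a f (lift ord0 k) 0 = f k.
Proof. by rewrite mxE liftK. Qed.

Lemma col4P (v w : 'cV[R]_4) : v ord0 0 = w ord0 0 ->
  (forall k, v (lift ord0 k) 0 = w (lift ord0 k) 0) -> v = w.
Proof.
by move=> v0 vS; apply/colP => i; case: (unliftP ord0 i) => [k|] ->.
Qed.

Lemma mink_lvec k b w :
  mink (lvec R k b) w = (-1) ^+ b * s2 * w (lift ord0 k) 0 - w ord0 0.
Proof.
rewrite minkE lvec0 (bigD1 k) //= big1 => [|i ik]; last first.
  by rewrite lvecS (negPf ik) mulr0 mul0r.
by rewrite lvecS eqxx mulr1; ring.
Qed.

Lemma mink_mvec e w : mink (mvec R e) w =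
  \sum_k (-1) ^+ e k * w (lift ord0 k) 0 - s2 * w ord0 0.
Proof.
by rewrite minkE mvec0 addrC; congr (_ - _); apply: eq_bigr => k _; rewrite mvecS.
Qed.

(** Orthogonality to the [lvec] makes each signed space coordinate equal to w_0 / sqrt 2;
    orthogonality to [mvec e] then reads 3 w_0 = 2 w_0. *)
Lemma mvec_frame_inj e w : mink (mvec R e) w = 0 ->
  (forall k, mink (lvec R k (e k)) w = 0) -> w = 0.
Proof.
rewrite mink_mvec => mw0 lw0.
have wS k : (-1) ^+ e k * w (lift ord0 k) 0 = w ord0 0 / s2.
  apply/(canRL (mulfK sqrt2_neq0)); move: (lw0 k); rewrite mink_lvec => /subr0_eq <-.
  by ring.
have w0 : w ord0 0 = 0.
  move: mw0; rewrite (eq_bigr _ (fun k _ => wS k)) sumr_const card_ord.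
  move=> /(congr1 ( *%R s2)); rewrite mulr0 mulrBr mulrA sqrt2M mulrnAr mulrC.
  rewrite (divfK sqrt2_neq0); lra.
apply: col4P => [|k]; rewrite mxE //.
by move: (wS k); rewrite w0 mul0r => /eqP; rewrite mulf_eq0 signr_eq0 => /eqP.
Qed.

Lemma mvec_frame_surj e (u : 'I_3 -> R) : exists w,
  mink (mvec R e) w = 0 /\ forall k, mink (lvec R k (e k)) w = u k.
Proof.
pose U := \sum_k u k.
(* The [lvec] equations give signed space coordinates (u_k + w_0) / sqrt 2; orthogonality to
   [mvec e] then reads U + 3 w_0 = 2 w_0, so w_0 = - U. *)
exists (tscol (- U) (fun k => (-1) ^+ e k * (u k - U) / s2)); split=> [|k].
  rewrite mink_mvec tscol0 (eq_bigr (fun k => (u k - U) / s2)) => [|k _].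
    rewrite -mulr_suml sumrB sumr_const card_ord -/U.
    apply: (mulfI sqrt2_neq0); rewrite mulr0 mulrBr (mulrA s2 s2) sqrt2M.
    rewrite [s2 * _]mulrC (divfK sqrt2_neq0); ring.
  by rewrite tscolS -!mulrA mulrA -expr2 sqrr_sign mul1r.
rewrite mink_lvec tscol0 tscolS mulrAC -mulrA [_ / s2 * s2](divfK sqrt2_neq0).
by rewrite mulrA -expr2 sqrr_sign; ring.
Qed.

(** * Cocycles as families of infinitesimal motions of the normals *)

Lemma rho_gen s (X : so13 R) : rho (gen s) X = Ad R (rho0_gen R s) X.
Proof. by rewrite /rep_comp /= -rho0E. Qed.

(** As [Ad] is trivial on -id, the relation of order two gives t = - t. *)
Lemma cocycle_Pgen (t : Z1 rho) e : t (gen (Pgen e)) = 0.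
Proof.
have := cocycle_invol t (racg_gen2 comm22 (Pgen e)).
rewrite rho_gen Ad_opp => /eqP; rewrite -addr_eq0 -mulr2n -scaler_nat.
by rewrite scaler_eq0 pnatr_eq0 => /eqP.
Qed.

(* These recover the vector w of v /\ w, as (v /\ w) v = w.                   *)
Definition mdef (t : Z1 rho) e : 'cV[R]_4 := t (gen (Mgen e)) *m mvec R e.
Definition ldef (t : Z1 rho) k b : 'cV[R]_4 := t (gen (Lgen k b)) *m lvec R k b.

Lemma cocycle_Mgen t e : t (gen (Mgen e)) = wedge (mvec R e) (mdef t e).
Proof.
apply: (Ad_refl_anti (v1 := mvec_unit R e)); rewrite -(rho_gen (Mgen e)).
exact/cocycle_invol/racg_gen2.
Qed.

Lemma cocycle_Lgen t k b : t (gen (Lgen k b)) = wedge (lvec R k b) (ldef t k b).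
Proof.
apply: (Ad_refl_anti (v1 := lvec_unit R k b)); rewrite -(rho_gen (Lgen k b)).
exact/cocycle_invol/racg_gen2.
Qed.

Lemma mdef_orth t e : mink (mvec R e) (mdef t e) = 0.
Proof. exact: mink_skew_self. Qed.

Lemma ldef_orth t k b : mink (lvec R k b) (ldef t k b) = 0.
Proof. exact: mink_skew_self. Qed.

Lemma mdef_ldef t e k :
  mink (mvec R e) (ldef t k (e k)) + mink (lvec R k (e k)) (mdef t e) = 0.
Proof.
have cml : comm22 (Mgen e) (Lgen k (e k)) by rewrite /= eqxx.
apply/(Ad_refl_comm (mvec_unit R e) (lvec_unit R k (e k))).
- exact: mvec_lvec.
- exact: mdef_orth.
- exact: ldef_orth.
rewrite -cocycle_Mgen -cocycle_Lgen -(rho_gen (Mgen e)) -(rho_gen (Lgen k _)).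
by rewrite -!cocycleM racg_genC.
Qed.

Lemma ldef_inj t : (forall k b, ldef t k b = 0) -> t = 0.
Proof.
move=> l0; apply: racg_cocycle_eq => s; change (t (gen s) = 0).
case: s => [e|e|k b]; first exact: cocycle_Pgen.
  rewrite cocycle_Mgen (@mvec_frame_inj e (mdef t e)) ?wedge0r ?mdef_orth // => k.
  by have := mdef_ldef t e k; rewrite l0 -[0 in LHS](scale0r 0) minkZr mul0r add0r.
by rewrite cocycle_Lgen l0 wedge0r.
Qed.

Lemma ldef_surj W : (forall k b, mink (lvec R k b) (W k b) = 0) ->
  exists t, ldef t = W.
Proof.
move=> lW.
have /choice[M MP] e := mvec_frame_surj e (fun k => - mink (mvec R e) (W k (e k))).
pose T s := match s with
  | Pgen e => 0
  | Mgen e => wedge (mvec R e) (M e)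
  | Lgen k b => wedge (lvec R k b) (W k b)
  end.
have TP e : T (Pgen e) = 0 by [].
have TM e : T (Mgen e) = wedge (mvec R e) (M e) by [].
have TL k b : T (Lgen k b) = wedge (lvec R k b) (W k b) by [].
have [|s s'|t tT] := @racg_cocycle_extend _ _ comm22 _ rho T.
- case=> [e|e|k b]; first by rewrite TP linrep0 oppr0.
    by rewrite TM rho_gen Ad_refl_wedge //; case: (MP e).
  by rewrite TL rho_gen Ad_refl_wedge.
- case: s s' => [e|e|k b] [d|d|j c] // cst.
  + by rewrite TP linrep0 addr0 add0r rho_gen Ad_opp.
  + by rewrite TP linrep0 addr0 add0r rho_gen Ad_opp.
  rewrite TM TL !rho_gen; have [me ml] := MP e; apply/Ad_refl_comm => //.
    exact/mvec_lvec/eqP.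
  by rewrite -(eqP cst) ml subrr.
exists t; apply/funext => k; apply/funext => b.
by rewrite /ldef tT wedge_unit ?lvec_unit.
Qed.

Lemma ldef_coboundary X k b :
  ldef (coboundary_of rho X) k b = (- 2 *: X) *m lvec R k b.
Proof.
set l := lvec R k b; set r := rho0_gen R (Lgen k b).
have Xl : mink l (X *m l) = 0 := mink_skew_self X l.
have rl : r *m l = - l by rewrite refl_mx_self ?lvec_unit.
(* The reflection negates l but fixes X l, which is orthogonal to l. *)
have AX : Ad R r X *m l = - (X *m l).
  by rewrite -[in LHS](opprK l) -rl -mulmxN AdE 2!mulmxN refl_mx_orth.
have -> : (- 2 *: X) *m l = - (X *m l) + - (X *m l).
  by rewrite -mulr2n -scaler_nat scalerN -scaleNr [RHS]scalemxAl.
rewrite -{1}AX -rho_gen -mulNmx.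
exact: (so13_mulmxD (rho (gen (Lgen k b)) X) (- X) l).
Qed.

(** * Twelve invariants detecting the coboundaries *)

(* With l_{k,s} = e_0 + s sqrt 2 e_k, the coboundary W = X l has              *)
(* ysum W k = 2 X e_0 and zdif W k = 2 sqrt 2 X e_k. The invariants below say *)
(* that X e_0 has no time component and does not depend on k, and that the    *)
(* space block of X is skew. Indices k + 1, k + 2 are modulo 3.               *)
Definition ysum W k := W k false + W k true.
Definition zdif W k := W k false - W k true.

Lemma ysumE W k i : ysum W k i 0 = W k false i 0 + W k true i 0.
Proof. by rewrite mxE. Qed.

Lemma zdifE W k i : zdif W k i 0 = W k false i 0 - W k true i 0.
Proof. by rewrite !mxE. Qed.

(** Column 0 holds the 3 time components and the off-diagonal space entries the 6 differences. The
    differences leave the diagonal free; its entry k stores the skewness defect of the pair k + 1, k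
    + 2. *)
Definition h1_coord W : 'M[R]_(3, 4) := \matrix_(k, j)
  if unlift ord0 j is Some i then
    if i == k then zdif W (k + 1) (lift ord0 (k + 2)) 0
                 + zdif W (k + 2) (lift ord0 (k + 1)) 0
    else ysum W k (lift ord0 i) 0 - ysum W i (lift ord0 i) 0
  else ysum W k ord0 0.

Lemma h1_coord0 W k : h1_coord W k ord0 = ysum W k ord0 0.
Proof. by rewrite mxE unlift_none. Qed.

Lemma h1_coordS W k i : i != k -> h1_coord W k (lift ord0 i) =
  ysum W k (lift ord0 i) 0 - ysum W i (lift ord0 i) 0.
Proof. by move=> ik; rewrite mxE liftK (negPf ik). Qed.

Lemma h1_coordD W k : h1_coord W k (lift ord0 k) =
  zdif W (k + 1) (lift ord0 (k + 2)) 0 + zdif W (k + 2) (lift ord0 (k + 1)) 0.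
Proof. by rewrite mxE liftK eqxx. Qed.

(** Brings the skewness condition for any pair of distinct indices to the form stored on the
    diagonal of [h1_coord]. *)
Lemma ord3_pair (i j : 'I_3) : i != j ->
  exists k, (i, j) = (k + 1, k + 2) \/ (i, j) = (k + 2, k + 1).
Proof.
case: i j => [[|[|[|//]]] ?] [[|[|[|//]]] ?] // _;
  [exists 2|exists 1|exists 2|exists 0|exists 1|exists 0];
  by [left; congr pair; exact: val_inj|right; congr pair; exact: val_inj].
Qed.

(** This is why [h1_coord] may ignore the time component of [zdif W k] and its k-th space component:
    orthogonality expresses both through [ysum W k]. *)
Lemma orth_ysum W k : (forall b, mink (lvec R k b) (W k b) = 0) ->
  ysum W k ord0 0 = s2 * zdif W k (lift ord0 k) 0 /\
  zdif W k ord0 0 = s2 * ysum W k (lift ord0 k) 0.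
Proof.
move=> lW; move: (lW false) (lW true); rewrite !mink_lvec expr0 expr1 !mxE.
by move=> /subr0_eq <- /subr0_eq <-; split; ring.
Qed.

Lemma so13_pred_entries (X : 'M[R]_4) : X ord0 ord0 = 0 ->
    (forall k, X ord0 (lift ord0 k) = X (lift ord0 k) ord0) ->
    (forall i k, X (lift ord0 i) (lift ord0 k) = - X (lift ord0 k) (lift ord0 i)) ->
  X \in @so13_pred R.
Proof.
move=> X00 X0S XSS; apply/eqP/matrixP => i j.
rewrite mul_mx_diag mul_diag_mx !mxE.
case: (unliftP ord0 i) => [i'|] ->; case: (unliftP ord0 j) => [j'|] -> /=;
  rewrite ?eqxx ?X00 ?X0S ?(XSS i'); ring.
Qed.

Lemma so13_entries X :
  [/\ X ord0 ord0 = 0,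
      forall k, X ord0 (lift ord0 k) = X (lift ord0 k) ord0 &
      forall i k, X (lift ord0 i) (lift ord0 k) = - X (lift ord0 k) (lift ord0 i)].
Proof.
have /eqP/matrixP E := so13P X.
have {}E i j := E i j; rewrite mul_mx_diag mul_diag_mx in E.
split=> [|k|i k].
- by move: (E ord0 ord0); rewrite !mxE /=; lra.
- by move: (E (lift ord0 k) ord0); rewrite !mxE /=; lra.
- by move: (E (lift ord0 k) (lift ord0 i)); rewrite !mxE /=; lra.
Qed.

Lemma mulmx_lvec (M : 'M[R]_4) k b i :
  (M *m lvec R k b) i 0 = M i ord0 + (-1) ^+ b * s2 * M i (lift ord0 k).
Proof. by rewrite mulmxDr -scalemxAr -!colE !mxE. Qed.

Lemma h1_coord_so13 X : h1_coord (fun k b => X *m lvec R k b) = 0.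
Proof.
have [X00 X0S XSS] := so13_entries X.
apply/matrixP => k j; rewrite [RHS]mxE; case: (unliftP ord0 j) => [i|] ->.
  have [->|ik] := eqVneq i k.
    rewrite h1_coordD !zdifE !mulmx_lvec expr0 expr1 (XSS (k + 1)); ring.
  rewrite h1_coordS // !ysumE !mulmx_lvec expr0 expr1; ring.
rewrite h1_coord0 ysumE !mulmx_lvec X00 expr0 expr1; ring.
Qed.

Lemma h1_coord_inj W : (forall k b, mink (lvec R k b) (W k b) = 0) ->
  h1_coord W = 0 -> exists X : so13 R, forall k b, X *m lvec R k b = W k b.
Proof.
move=> lW W0.
have Y0 k : ysum W k ord0 0 = 0 by rewrite -h1_coord0 W0 mxE.
have YS k i : ysum W k (lift ord0 i) 0 = ysum W i (lift ord0 i) 0.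
  have [->//|ik] := eqVneq i k.
  by apply/subr0_eq; rewrite -h1_coordS // W0 mxE.
have ZS i k : i != k -> zdif W i (lift ord0 k) 0 = - zdif W k (lift ord0 i) 0.
  move=> /ord3_pair[j ij]; apply/eqP; rewrite -addr_eq0.
  have: h1_coord W j (lift ord0 j) = 0 by rewrite W0 mxE.
  rewrite h1_coordD; case: ij => [[-> ->] ->|[-> ->]]; first by rewrite eqxx.
  by rewrite addrC => ->; rewrite eqxx.
(* The boost and rotation parts of X, solved from [ysum] = 2 X e_0 and [zdif] = 2 sqrt 2 X e_k. *)
pose bo k := ysum W k (lift ord0 k) 0 / 2.
pose ro i k := if i == k then 0 else zdif W k (lift ord0 i) 0 / (2 * s2).
pose X : 'M[R]_4 := \matrix_(i, j)
  match unlift ord0 i, unlift ord0 j with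
  | Some i', Some j' => ro i' j'
  | Some k, None | None, Some k => bo k
  | None, None => 0
  end.
have X00 : X ord0 ord0 = 0 by rewrite mxE unlift_none.
have X0S k : X ord0 (lift ord0 k) = bo k by rewrite mxE unlift_none liftK.
have XS0 k : X (lift ord0 k) ord0 = bo k by rewrite mxE unlift_none liftK.
have XSS i k : X (lift ord0 i) (lift ord0 k) = ro i k by rewrite mxE !liftK.
have Xso : X \in @so13_pred R.
  apply: so13_pred_entries => // [k|i k]; first by rewrite X0S XS0.
  rewrite !XSS /ro eq_sym; case: eqVneq => [|ki]; first by rewrite oppr0.
  by rewrite (ZS k i) // mulNr.
exists (MkSo13 Xso) => k b; rewrite /=.
have [Yk Zk] := orth_ysum (lW k).
have WE i : W k b i 0 = 2^-1 * (ysum W k i 0 + (-1) ^+ b * zdif W k i 0).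
  by rewrite ysumE zdifE; case: (b); rewrite ?expr0 ?expr1; field.
apply: col4P => [|i]; rewrite mulmx_lvec WE.
  by rewrite X00 X0S Zk Y0 /bo; field.
rewrite XS0 XSS (YS k i) /ro; case: eqVneq => [->|_].
  have -> : zdif W k (lift ord0 k) 0 = 0.
    by apply: (mulfI sqrt2_neq0); rewrite -Yk Y0 mulr0.
  by rewrite /bo; field.
by rewrite /bo; field; exact: sqrt2_neq0.
Qed.

Lemma h1_coord_surj (M : 'M[R]_(3, 4)) : exists2 W,
  forall k b, mink (lvec R k b) (W k b) = 0 & h1_coord W = M.
Proof.
(* Prescribed [ysum] and [zdif]. The k-th space entry of Y k is set to 0, so orthogonality forces
   time component 0 in Z k and k-th entry M k 0 / sqrt 2. Modulo 3, - i - k is the third index; its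
   diagonal entry of M is split evenly between the two [zdif] terms. *)
pose Y k := tscol (M k ord0) (fun i => if i == k then 0 else M k (lift ord0 i)).
pose Z k := tscol 0 (fun i => if i == k then M k ord0 / s2
                              else M (- i - k) (lift ord0 (- i - k)) / 2).
pose W k b := 2^-1 *: (Y k + (-1) ^+ b *: Z k).
have YE k : ysum W k = Y k.
  by apply/colP => i; rewrite /ysum /W expr0 expr1 !mxE; field.
have ZE k : zdif W k = Z k.
  by apply/colP => i; rewrite /zdif /W expr0 expr1 !mxE; field.
exists W => [k b|].
  have WE i : W k b i 0 = 2^-1 * (Y k i 0 + (-1) ^+ b * Z k i 0).
    by rewrite mxE mxE [X in _ + X]mxE.
  rewrite mink_lvec !WE !tscol0 !tscolS eqxx.
  by case: b {WE}; rewrite ?expr0 ?expr1; field; exact: sqrt2_neq0.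
apply/matrixP => k j; case: (unliftP ord0 j) => [i|] ->.
  have [->|ik] := eqVneq i k.
    have k1 : - (k + 2) - (k + 1) = k.
      by apply/val_inj; case: k => -[|[|[]]].
    have k2 : - (k + 1) - (k + 2) = k by rewrite addrC.
    have k3 : (k + 2 == k + 1) = false by rewrite (inj_eq (addrI k)).
    by rewrite h1_coordD !ZE /Z !tscolS k1 k2 k3 eq_sym k3; field.
  by rewrite h1_coordS // !YE /Y !tscolS eqxx (negPf ik) subr0.
by rewrite h1_coord0 YE tscol0.
Qed.

(** * The linear map on cocycles and its kernel *)

Definition h1_map t : 'rV[R]_(3 * 4) := mxvec (h1_coord (ldef t)).

Lemma ldefD a t u k b : ldef (a *: t + u) k b = a *: ldef t k b + ldef u k b.
Proof. by rewrite /ldef scalemxAl -mulmxDl. Qed.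

Lemma h1_map_linear : linear h1_map.
Proof.
move=> a t u; rewrite /h1_map -linearP; congr mxvec.
have dE (v w : 'cV[R]_4) i : (a *: v + w) i 0 = a * v i 0 + w i 0.
  by rewrite !mxE.
apply/matrixP => k j; rewrite [RHS]mxE [X in _ = X + _]mxE.
case: (unliftP ord0 j) => [i|] ->; last first.
  rewrite !h1_coord0 !ysumE !ldefD !dE; move: (ldef t) (ldef u) => p q; ring.
have [->|ik] := eqVneq i k.
  rewrite !h1_coordD !zdifE !ldefD !dE; move: (ldef t) (ldef u) => p q; ring.
rewrite !h1_coordS // !ysumE !ldefD !dE; move: (ldef t) (ldef u) => p q; ring.
Qed.

HB.instance Definition _ :=
  GRing.isLinear.Build R (Z1 rho) 'rV[R]_(3 * 4) *:%R h1_map h1_map_linear.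

Lemma h1_map_eq0 t : h1_map t = 0 <-> t \in @coboundary _ _ _ rho.
Proof.
split=> [t0|/coboundaryP[X ->]].
  have [|X XE] := h1_coord_inj (ldef_orth t).
    by apply/(can_inj mxvecK); rewrite linear0.
  (* The factor - 1/2 cancels the - 2 of [ldef_coboundary]; [ldef_inj] shows that the difference of
     the two cocycles is zero. *)
  apply/coboundaryP; exists (- 2^-1 *: X); apply/eqP; rewrite -subr_eq0.
  apply/eqP/ldef_inj => k b; rewrite -scaleN1r addrC ldefD ldef_coboundary.
  by rewrite scalerA mulrNN divff ?pnatr_eq0 // scale1r XE scaleN1r addNr.
apply/(can_inj vec_mxK); rewrite mxvecK linear0 -(h1_coord_so13 (- 2 *: X)).
by congr h1_coord; apply/funext => k; apply/funext => b; exact: ldef_coboundary.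
Qed.

End Deformations.

Theorem proposition7p2 (R : realType) :
  inhabited (Vector.axiom 12 (H1 (rep_comp (Ad R) (rho0 R)))).
Proof.
have := @H1_vector_axiom R Gamma22 _ (rep_comp (Ad R) (rho0 R)) (3 * 4) (@h1_map R).
apply => [|x]; first exact: h1_map_eq0.
have [W lW WM] := h1_coord_surj (vec_mx (x : 'rV_(3 * 4))).
have [t tW] := ldef_surj lW.
by exists t; rewrite /= /h1_map tW WM vec_mxK.
Qed.
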